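(* Let $(X,\mathcal{S},\mu)$ be a measure space, let $p\in[1,\infty)$ and let $q\in(1,\infty]$ be such that $1/p+1/q=1$. Then the multiplication $L_p\times L_q\ni (f,g)\mapsto fg\in L_1$ is a uniformly open mapping. More exactly, for any $\varepsilon>0$ and any $(f,g)\in L_p\times L_q$, $$\mathrm{B}_1\left(fg,\frac{\varepsilon^2}{4}\right)\subseteq \mathrm{B}_{p}(f,\varepsilon)\cdot \mathrm{B}_{q}(g,\varepsilon).$$
   Context: $(X,\mathcal{S},\mu)$ is an arbitrary measure space ($\mu$ a measure on the $\sigma$-algebra $\mathcal{S}$ of subsets of $X$; no finiteness or $\sigma$-finiteness is assumed). $L_p=L_p(X)$, $p\in[1,\infty]$, is the usual Banach space of (classes of a.e. equal) real-valued $\mathcal{S}$-measurable functions with norm $\|\cdot\|_p$ ($\|\cdot\|_\infty$ is the essential supremum norm), and $1/\infty=0$. $\mathrm{B}_p(f,r)$ is the open ball in $L_p$ with center $f$ and radius $r>0$. For $A\subseteq L_p$, $B\subseteq L_q$, $A\cdot B=\{uv: u\in A,\ v\in B\}\subseteq L_1$, where products are pointwise (well defined in $L_1$ by Hölder's inequality). A mapping $F\colon Y\to Z$ between metric spaces is uniformly open if for every $\varepsilon>0$ there is $\delta>0$ such that $\mathrm{B}(F(y),\delta)\subseteq F[\mathrm{B}(y,\varepsilon)]$ for all $y\in Y$ ($\mathrm{B}(z,r)$ denotes the open ball). For the multiplication $L_p\times L_q\to L_1$ this means: for every $\varepsilon>0$ there is $\delta>0$ such that $\mathrm{B}_1(fg,\delta)\subseteq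 \mathrm{B}_p(f,\varepsilon)\cdot \mathrm{B}_q(g,\varepsilon)$ for all $(f,g)\in L_p\times L_q$. *)

(* Defs.v *)
From HB Require Import structures.
From mathcomp Require Import all_boot all_order all_algebra.
From mathcomp Require Import all_classical all_reals all_analysis.
From mathcomp Require Import measurable_realfun ess_sup_inf hoelder.

Set Implicit Arguments.
Unset Strict Implicit.
Unset Printing Implicit Defensive.
Import Order.TTheory GRing.Theory Num.Theory.
Import numFieldNormedType.Exports.

Local Open Scope classical_set_scope.
Local Open Scope ring_scope.

Definition uniformly_open (R : numFieldType) (Y Z : pseudoMetricType R)
    (F : Y -> Z) : Prop :=
  forall e : R, 0 < e -> exists2 d : R, 0 < d &
    forall y : Y, ball (F y) d `<=` F @` ball y e.

Section Lnorm_extra.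
Context d (T : measurableType d) (R : realType).
Variable mu : {measure set T -> \bar R}.
Local Open Scope ereal_scope.
Implicit Types (p q : \bar R) (f g : T -> R).

Lemma ae_eq_Lnorm p f g : 1 <= p ->
  measurable_fun [set: T] f -> measurable_fun [set: T] g ->
  f = g %[ae mu] -> 'N[mu]_p[EFin \o f] = 'N[mu]_p[EFin \o g].
Proof.
move=> + mf mg fg; rewrite unlock; case: p => [r||//].
- rewrite lee_fin => r1; congr (_ `^ _).
  apply: ae_eq_integral => //.
  + apply/measurable_EFinP.
    apply: (@measurableT_comp _ _ _ _ _ _ (@powR R ^~ r)) => //.
    exact: measurableT_comp.
  + apply/measurable_EFinP.
    apply: (@measurableT_comp _ _ _ _ _ _ (@powR R ^~ r)) => //.
    exact: measurableT_comp.
  + by apply: filterS fg => x /(_ I) fgx _ /=; rewrite fgx.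
- move=> _; case: ifPn => // _; apply: eq_ess_sup.
  by apply: filterS fg => x /(_ I) fgx /=; rewrite fgx.
Qed.

Lemma Lnorm_mul1y f g :
  measurable_fun [set: T] f -> measurable_fun [set: T] g ->
  'N[mu]_+oo[EFin \o g] < +oo ->
  'N[mu]_1[EFin \o (f \* g)%R] <= 'N[mu]_1[EFin \o f] * 'N[mu]_+oo[EFin \o g].
Proof.
move=> mf mg; set M := 'N[mu]_+oo[_] => Moo.
have M0 : 0 <= M by exact: Lnorm_ge0.
have Mfin : M \is a fin_num by rewrite ge0_fin_numE.
have gM : \forall x \ae mu, `|(g x)%:E| <= M.
  rewrite /M unlock; case: ifPn => [mu0|]; first exact: ess_sup_ge.
  rewrite -leNgt => mu0; exists setT; split => //.
  by apply/eqP; rewrite eq_le mu0 measure_ge0.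
rewrite !Lnorm1 -(fineK Mfin) muleC -ge0_integralZl//; last 2 first.
  by apply/measurable_EFinP; exact: measurableT_comp.
  by rewrite lee_fin fine_ge0.
apply: ae_ge0_le_integral => //.
- by apply/measurable_EFinP; apply: measurableT_comp => //; exact: measurable_funM.
- by move=> x _; rewrite mule_ge0// lee_fin fine_ge0.
- apply/measurable_EFinP; apply: measurable_funM => //.
  exact: measurableT_comp.
- apply: filterS gM => x gx _ /=.
  by rewrite normrM mulrC EFinM lee_wpmul2r// fineK.
Qed.

Lemma Lnorm_mul_lty p q f g : 1 <= p -> 1 <= q -> p^-1 + q^-1 = 1 ->
  measurable_fun [set: T] f -> measurable_fun [set: T] g ->
  'N[mu]_p[EFin \o f] < +oo -> 'N[mu]_q[EFin \o g] < +oo ->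
  'N[mu]_1[EFin \o (f \* g)%R] < +oo.
Proof.
have bnd a b : 0 <= a -> 0 <= b -> a < +oo -> b < +oo -> a * b < +oo :> \bar R.
  by move=> a0 b0 aoo boo; apply: lte_mul_pinfty; rewrite // ge0_fin_numE.
case: p => [p||//] p1; case: q => [q||//] q1 pq mf mg Nf Ng.
- have p0 : (0 < p)%R by rewrite (lt_le_trans ltr01).
  have q0 : (0 < q)%R by rewrite (lt_le_trans ltr01).
  move: pq; rewrite !inver !gt_eqF// -EFinD => -[pq].
  by apply: le_lt_trans (hoelder mu mf mg p0 q0 pq) _; apply: bnd => //; exact: Lnorm_ge0.
- move: pq Nf; rewrite invey adde0 => /eqP; rewrite inve_eq1 => /eqP -> Nf.
  by apply: le_lt_trans (Lnorm_mul1y mf mg Ng) _; apply: bnd => //; exact: Lnorm_ge0.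
- move: pq Ng; rewrite invey add0e => /eqP; rewrite inve_eq1 => /eqP -> Ng.
  rewrite (_ : (f \* g)%R = (g \* f)%R); last first.
    by apply/funext => x /=; rewrite mulrC.
  by apply: le_lt_trans (Lnorm_mul1y mg mf Nf) _; apply: bnd => //; exact: Lnorm_ge0.
- by move: pq; rewrite invey adde0 => /eqP; rewrite eqe eq_sym oner_eq0.
Qed.

End Lnorm_extra.

Section Lspace_metric.
Context d (T : measurableType d) (R : realType).
Variables (mu : {measure set T -> \bar R}) (p : \bar R) (p1 : (1 <= p)%E).
Implicit Types f g h : LspaceType mu p1.

Lemma Lspace_measurable f : measurable_fun [set: T] (f : T -> R).
Proof. exact: (@measurable_funPT _ _ _ _ (repr (LebesgueSpace.sort f))). Qed.

Lemma Lspace_finite f : finite_norm mu p (f : T -> R).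
Proof. exact: Lebesgue_finite. Qed.

Lemma Lspace_eqP f g : f = g <-> (f : T -> R) = (g : T -> R) %[ae mu].
Proof.
split=> [->|fg]; first exact: ae_eq_refl.
have E : f = g :> {mfun_ mu, T >-> measurableTypeR R}.
  have /eqP := introT (ae_eqP (LebesgueSpace.sort f) (LebesgueSpace.sort g)) fg.
  by rewrite !reprK.
case: f g E {fg} => f [[Pf]] [g [[Pg]]] /= E; subst g.
by rewrite (Prop_irrelevance Pf Pg).
Qed.

(* The values of f and g are those of representatives of their classes; the
   choice is immaterial by ae_eq_Lnorm. *)
Definition Lspace_dist f g : R :=
  fine ('N[mu]_p[EFin \o (fun x => (f x : R) - g x)%R])%E.

Let submeas f g : measurable_fun [set: T] (fun x => (f x : R) - g x).
Proof. by apply: measurable_funB; exact: Lspace_measurable. Qed.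

Let triangle g f h : ('N[mu]_p[EFin \o (fun x => (f x : R) - h x)%R] <=
  'N[mu]_p[EFin \o (fun x => (f x : R) - g x)%R] +
  'N[mu]_p[EFin \o (fun x => (g x : R) - h x)%R])%E.
Proof.
rewrite [X in (X <= _)%E](_ : _ =
  'N[mu]_p[EFin \o ((fun x => (f x : R) - g x) \+
                    (fun x => (g x : R) - h x))%R])%E.
  exact: eminkowski.
by apply: eq_Lnorm => x /=; rewrite addrA subrK.
Qed.

Let fin_sub f g : ('N[mu]_p[EFin \o (fun x => (f x : R) - g x)%R])%E
  \is a fin_num.
Proof.
rewrite ge0_fin_numE ?Lnorm_ge0//.
have mg : measurable_fun [set: T] (fun x => - (g x : R)).
  by apply: measurableT_comp => //; exact: Lspace_measurable.
apply: le_lt_trans (eminkowski mu (Lspace_measurable f) mg p1) _.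
rewrite lte_add_pinfty//; first exact: Lspace_finite.
by have := Lspace_finite g; rewrite /finite_norm -oppe_Lnorm.
Qed.

Lemma Lspace_distE f g : (Lspace_dist f g)%:E =
  ('N[mu]_p[EFin \o (fun x => (f x : R) - g x)%R])%E.
Proof. by rewrite /Lspace_dist fineK. Qed.

Lemma Lspace_distxx f : Lspace_dist f f = 0.
Proof.
rewrite /Lspace_dist (_ : _ \o _ = cst 0%E); last first.
  by apply/funext => x /=; rewrite subrr.
by rewrite Lnorm0// gt_eqF// (lt_le_trans _ p1).
Qed.

Lemma Lspace_dist_eq0 f g : Lspace_dist f g = 0 -> f = g.
Proof.
move=> fg0; apply/Lspace_eqP.
have : ('N[mu]_p[EFin \o (fun x => (f x : R) - g x)%R])%E = 0%E.
  by rewrite -Lspace_distE fg0.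
move/Lnorm_eq0_eq0 => /(_ _ (lt_le_trans lte01 p1)) H.
have /H : measurable_fun setT (EFin \o (fun x => (f x : R) - g x)).
  exact/measurable_EFinP.
by apply: filterS => x /(_ I) [] /eqP; rewrite subr_eq0 => /eqP.
Qed.

Lemma Lspace_dist_sym f g : Lspace_dist f g = Lspace_dist g f.
Proof.
rewrite /Lspace_dist -oppe_Lnorm; congr fine.
by apply: eq_Lnorm => x /=; rewrite opprB.
Qed.

Lemma Lspace_dist_triangle g f h :
  Lspace_dist f h <= Lspace_dist f g + Lspace_dist g h.
Proof. by rewrite -lee_fin EFinD !Lspace_distE. Qed.

HB.instance Definition _ := gen_eqMixin (LspaceType mu p1).
HB.instance Definition _ := gen_choiceMixin (LspaceType mu p1).
HB.instance Definition _ := @isMetric.Build R (LspaceType mu p1) Lspace_dist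
  Lspace_distxx Lspace_dist_eq0 Lspace_dist_sym Lspace_dist_triangle.

Lemma Lspace_ballE f e : ball f e = [set g | Lspace_dist f g < e].
Proof. exact: ballEmdist. Qed.

End Lspace_metric.

Section Lspace_class.
Context d (T : measurableType d) (R : realType).
Variables (mu : {measure set T -> \bar R}) (p : \bar R) (p1 : (1 <= p)%E).
Variables (u : T -> R) (uP : u \in Lfun mu p).

Let um : measurable_fun [set: T] (u : T -> measurableTypeR R).
Proof. exact: (set_mem (sub_Lfun_mfun uP)). Qed.

Let umfun : {mfun T >-> measurableTypeR R} :=
  HB.pack u (isMeasurableFun.Build _ _ T (measurableTypeR R) u um).

Let uclass : {mfun_ mu, T >-> measurableTypeR R} := (\pi umfun)%qT.

Let uclass_ae : (uclass : T -> R) = u %[ae mu].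
Proof.
have /eqquotP/asboolP := reprK uclass.
exact.
Qed.

Let uclass_finite : finite_norm mu p (uclass : T -> R).
Proof.
rewrite /finite_norm (ae_eq_Lnorm p1 _ um uclass_ae).
  exact: (set_mem (sub_Lfun_finLfun uP)).
exact: (@measurable_funPT _ _ _ _ (repr uclass)).
Qed.

Definition Lspace_class : LspaceType mu p1 :=
  HB.pack uclass (isFinLebesgue.Build d T R mu p p1 uclass uclass_finite).

Lemma Lspace_classE : (Lspace_class : T -> R) = u %[ae mu].
Proof. exact: uclass_ae. Qed.

End Lspace_class.

Section Lspace_mul.
Context d (T : measurableType d) (R : realType).
Variables (mu : {measure set T -> \bar R}) (p q : \bar R).
Variables (p1 : (1 <= p)%E) (q1 : (1 <= q)%E) (pq : (p^-1 + q^-1 = 1)%E).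

Lemma Lfun1_mul (f : LspaceType mu p1) (g : LspaceType mu q1) :
  (fun x => (f x : R) * g x) \in Lfun mu 1.
Proof.
apply/andP; split; rewrite inE /=.
  by apply: measurable_funM; exact: Lspace_measurable.
by apply: (Lnorm_mul_lty p1 q1 pq);
  [exact: Lspace_measurable..|exact: Lspace_finite|exact: Lspace_finite].
Qed.

(* The Hoelder conditions p1, q1, pq are needed only for the product to be in
   L_1; by Lspace_mulE and Lspace_eqP, the class does not depend on them. *)
Definition Lspace_mul (f : LspaceType mu p1) (g : LspaceType mu q1) :
  LspaceType1 mu := Lspace_class (lexx 1%E) (Lfun1_mul f g).

Lemma Lspace_mulE (f : LspaceType mu p1) (g : LspaceType mu q1) :
  (Lspace_mul f g : T -> R) = (fun x => (f x : R) * g x) %[ae mu].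
Proof. exact: Lspace_classE. Qed.

Definition Lspace_mul_set (A : set (LspaceType mu p1))
    (B : set (LspaceType mu q1)) : set (LspaceType1 mu) :=
  [set Lspace_mul u v | u in A & v in B].

End Lspace_mul.

(* Main.v *)
Require Import Defs.
From mathcomp Require Import all_boot all_order all_algebra.
From mathcomp Require Import all_classical all_reals all_analysis.
From mathcomp Require Import measurable_realfun ess_sup_inf lra.
Set Implicit Arguments.
Unset Strict Implicit.
Unset Printing Implicit Defensive.
Import Order.TTheory GRing.Theory Num.Theory.
Import numFieldNormedType.Exports.
Local Open Scope classical_set_scope.
Local Open Scope ring_scope.

(** The idea is to solve the problem pointwise with an explicit formula, and
    to split the error of the product between the two factors in proportion
    to the Hoelder exponents.

    Let h be within distance e^2/4 of f g in L_1, let w = h - f g, and choose m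
    strictly between the norm of w and e^2/4. Put c = 2 sqrt m, so c < e, and

      A = c (|w| / m)^(1/p),    B = c (|w| / m)^(1/q).

    Since 1/p + 1/q = 1, A B = c^2 |w| / m = 4 |w|. On the other hand the
    p-norm of A and the q-norm of B are at most c, because the 1-norm of |w| / m
    is at most 1; with the convention 1/oo = 0 this holds for infinite
    exponents too ([Lnorm_le_powR]). So it suffices to write h = u v with
    |f - u| <= A and |g - v| <= B pointwise and u, v measurable.

    The relation A B = 4 |w| is what makes this possible at every point. If y
    is so large that |w| <= A |y|, then x y + w = (x + w / y) y, and only the
    first factor moves, by at most A; likewise if |w| <= B |x|. Otherwise
    |x| < A / 4 and |y| < B / 4: both numbers are small against the allowed
    displacements, the product x y + w is at most 5 A B / 16 in absolute value,
    and A / 2 times 2 (x y + w) / A is an admissible factorization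
    ([factors_mul], [left_factor_close], [right_factor_close]). As the formula
    is built from arithmetic operations and comparisons, it is measurable in
    its data ([measurable_factors]), so no selection theorem is needed.

    Choosing m below e^2/4 strictly gives c < e, which keeps the perturbations
    in the open balls even for an infinite exponent, where the essential
    supremum of B can be equal to c. *)

(** * Factoring a perturbed product of two numbers *)

Section Factors.
Context {R : realFieldType}.
Implicit Types A B x y w : R.

Definition left_factor A B x y w : R :=
  if `|w| <= A * `|y| then x + w / y
  else if `|w| <= B * `|x| then x
  else A / 2.

Definition right_factor A B x y w : R :=
  if `|w| <= A * `|y| then y
  else if `|w| <= B * `|x| then y + w / x
  else (x * y + w) / (A / 2).

(** Valid at y = 0 as well, where the division returns 0; the same convention
    makes the next identity hold, since w is then 0. *)
Lemma norm_div_le A y w : 0 <= A -> `|w| <= A * `|y| -> `|w / y| <= A.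
Proof.
move=> A0; have [->|y0] := eqVneq y 0; first by rewrite invr0 mulr0 normr0.
by rewrite normrM normfV ler_pdivrMr ?normr_gt0.
Qed.

Lemma mul_div_norm_le A y w : `|w| <= A * `|y| -> y * (w / y) = w.
Proof.
have [->|y0] := eqVneq y 0; last by rewrite mulrCA divff// mulr1.
by rewrite normr0 mulr0 normr_le0 => /eqP ->; rewrite !mul0r.
Qed.

Section bounds.
Variables A B x y w : R.
Hypotheses (A0 : 0 <= A) (B0 : 0 <= B) (AB : A * B = 4 * `|w|).

(** When neither factor alone can absorb w, both are small against their
    allowed displacements, because A B / 4 = |w|. *)
Let small_factors : (`|w| <= A * `|y|) = false -> (`|w| <= B * `|x|) = false ->
  [/\ 0 < A, 0 < B, `|x| < A / 4 & `|y| < B / 4].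
Proof.
move=> /negbT; rewrite -ltNge => yA /negbT; rewrite -ltNge => xB.
have w0 : 0 < `|w| by apply: le_lt_trans yA; rewrite mulr_ge0.
have AB0 : 0 < A * B by rewrite AB mulr_gt0.
have Apos : 0 < A.
  by rewrite lt_def A0 andbT; apply: contraTneq AB0 => ->; rewrite mul0r ltxx.
have Bpos : 0 < B.
  by rewrite lt_def B0 andbT; apply: contraTneq AB0 => ->; rewrite mulr0 ltxx.
split=> //.
- rewrite -(ltr_pM2l Bpos); apply: lt_le_trans xB _.
  by rewrite mulrA (mulrC B) AB; lra.
- rewrite -(ltr_pM2l Apos); apply: lt_le_trans yA _.
  by rewrite mulrA AB; lra.
Qed.

Lemma factors_mul : left_factor A B x y w * right_factor A B x y w = x * y + w.
Proof.
rewrite /left_factor /right_factor; case: ifP => [yA|yA].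
  by rewrite mulrDl (mulrC (w / y)) (mul_div_norm_le yA).
case: ifP => [xB|xB]; first by rewrite mulrDr (mul_div_norm_le xB).
have [Apos _ _ _] := small_factors yA xB.
by rewrite mulrC divfK// mulf_neq0 ?invr_eq0 ?pnatr_eq0// gt_eqF.
Qed.

(** In the last case |x - A / 2| <= A / 4 + A / 2. *)
Lemma left_factor_close : `|x - left_factor A B x y w| <= A.
Proof.
rewrite /left_factor; case: ifP => [yA|yA].
  by rewrite opprD addNKr normrN norm_div_le.
case: ifP => [xB|xB]; first by rewrite subrr normr0.
have [Apos _ xA _] := small_factors yA xB.
by apply: le_trans (ler_normB _ _) _; rewrite (ger0_norm (x := A / 2)); lra.
Qed.

(** In the last case |x y + w| <= A B / 16 + A B / 4, so the second factor has
    absolute value at most 5 B / 8, while |y| < B / 4; these add up to less than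
    B. *)
Lemma right_factor_close : `|y - right_factor A B x y w| <= B.
Proof.
rewrite /right_factor; case: ifP => [yA|yA]; first by rewrite subrr normr0.
case: ifP => [xB|xB]; first by rewrite opprD addNKr normrN norm_div_le.
have [Apos Bpos xA yB] := small_factors yA xB.
have xyAB : `|x * y| <= A / 4 * (B / 4) by rewrite normrM ler_pM// ltW.
suff : `|(x * y + w) / (A / 2)| <= 5 / 8 * B.
  by move=> ?; apply: le_trans (ler_normB _ _) _; lra.
have A2 : 0 < A / 2 by lra.
rewrite normrM normfV (gtr0_norm A2) ler_pdivrMr//.
apply: le_trans (ler_normD _ _) _.
have -> : `|w| = A * B / 4 by rewrite AB; lra.
by lra.
Qed.

End bounds.
End Factors.

(** * Measurability of the factors *)

Section MeasurableFactors.
Context d (X : measurableType d) (R : realType).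
Implicit Types A B f g w : X -> R.

(** The formula x^-1 = x (x^2)^-1 reduces inversion, which is not monotone nor
    continuous at 0, to a real power of a nonnegative number. *)
Lemma measurable_inv : measurable_fun [set: R] (@GRing.inv R).
Proof.
rewrite (_ : GRing.inv = fun x : R => x * (x ^+ 2) `^ (-1)).
  apply: measurable_funM; first exact: measurable_id.
  apply: (measurableT_comp (f := @powR R ^~ (-1))); first exact: measurable_powR.
  exact: measurable_funX.
apply/funext => x; rewrite powR_inv1 ?sqr_ge0//.
have [->|x0] := eqVneq x 0; first by rewrite invr0 mul0r.
by rewrite expr2 invfM mulVKf.
Qed.

Lemma measurable_fun_div f g : measurable_fun [set: X] f ->
  measurable_fun [set: X] g -> measurable_fun [set: X] (fun x => f x / g x).
Proof.
move=> mf mg; apply: measurable_funM => //.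
exact: (measurableT_comp measurable_inv).
Qed.

Lemma measurable_factors A B f g w :
  measurable_fun [set: X] A -> measurable_fun [set: X] B ->
  measurable_fun [set: X] f -> measurable_fun [set: X] g ->
  measurable_fun [set: X] w ->
  measurable_fun [set: X] (fun x => left_factor (A x) (B x) (f x) (g x) (w x))
  /\ measurable_fun [set: X]
       (fun x => right_factor (A x) (B x) (f x) (g x) (w x)).
Proof.
move=> mA mB mf mg mw.
have mtest (C h : X -> R) : measurable_fun [set: X] C -> measurable_fun [set: X] h ->
    measurable_fun [set: X] (fun x => `|w x| <= C x * `|h x| :> R).
  move=> mC mh; apply: measurable_fun_ler; first exact: measurableT_comp.
  by apply: measurable_funM => //; exact: measurableT_comp.
have mA2 : measurable_fun [set: X] (fun x => A x / 2) by exact: measurable_funM.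
split; apply: measurable_fun_ifT => //; try exact: mtest.
- by apply: measurable_funD => //; exact: measurable_fun_div.
- by apply: measurable_fun_ifT => //; exact: mtest.
- apply: measurable_fun_ifT => //; first exact: mtest.
    by apply: measurable_funD => //; exact: measurable_fun_div.
  apply: measurable_fun_div => //; apply: measurable_funD => //.
  exact: measurable_funM.
Qed.

End MeasurableFactors.

(** * From pointwise bounds to norms *)

Section Norms.
Context d (X : measurableType d) (R : realType).
Variable mu : {measure set X -> \bar R}.

(** For finite p the p-th power of the bound is c^p |w| / m, whose integral is
    at most c^p; for infinite p the bound is the constant c. *)
Lemma Lnorm_le_powR (p : \bar R) (a w : X -> R) (c m : R) : (1 <= p)%E ->
  0 <= c -> 0 < m ->
  measurable_fun [set: X] a -> measurable_fun [set: X] w ->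
  (forall x, `|a x| <= c * (`|w x| / m) `^ fine p^-1) ->
  ('N[mu]_1[EFin \o w] <= m%:E)%E -> ('N[mu]_p[EFin \o a] <= c%:E)%E.
Proof.
move=> + c0 m0 ma mw; case: p => [r|_|//]; last first.
  rewrite invey => aw _; rewrite unlock; case: ifPn => _; last by rewrite lee_fin.
  apply/ess_supP; apply: aeW => x /=.
  by have := aw x; rewrite powRr0 mulr1 lee_fin.
rewrite lee_fin => r1; have r0 : 0 < r by exact: lt_le_trans r1.
rewrite inver gt_eqF//= => aw wm; rewrite unlock.
suff H : (\int[mu]_x (`|(EFin \o a) x| `^ r) <= (c `^ r)%:E)%E.
  rewrite [leRHS](_ : _ = ((c `^ r)%:E `^ r^-1)%E); last first.
    by rewrite poweR_EFin -powRrM divff ?gt_eqF// powRr1.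
  apply: gt0_ler_poweR => //; first by rewrite invr_ge0 ltW.
  - by rewrite in_itv/= leey andbT; apply: integral_ge0 => x _; rewrite lee_fin powR_ge0.
  - by rewrite in_itv/= leey andbT lee_fin powR_ge0.
apply: (@le_trans _ _ (\int[mu]_x ((c `^ r / m)%:E * `|(EFin \o w) x|))%E).
  apply: ge0_le_integral => //.
  - by move=> x _; exact: poweR_ge0.
  - apply/measurable_EFinP.
    apply: (@measurableT_comp _ _ _ _ _ _ (@powR R ^~ r)) => //.
    exact: measurableT_comp.
  - apply/measurable_EFinP; apply: measurable_funM => //.
    exact: measurableT_comp.
  - move=> x _; rewrite /= lee_fin.
    apply: (@le_trans _ _ ((c * (`|w x| / m) `^ r^-1) `^ r)).
      apply: ge0_ler_powR => //; rewrite ?nnegrE ?mulr_ge0 ?powR_ge0//.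
      exact: ltW.
    have wm0 : 0 <= `|w x| / m by rewrite divr_ge0// ltW.
    rewrite powRM ?powR_ge0// -powRrM mulVf ?gt_eqF// powRr1//.
    by rewrite mulrA mulrAC.
rewrite ge0_integralZl//; last 2 first.
- by apply/measurable_EFinP; exact: measurableT_comp.
- by rewrite lee_fin divr_ge0 ?powR_ge0// ltW.
rewrite -Lnorm1; apply: (@le_trans _ _ ((c `^ r / m)%:E * m%:E)%E).
  by apply: lee_wpmul2l => //; rewrite lee_fin divr_ge0 ?powR_ge0// ltW.
by rewrite -EFinM divfK ?gt_eqF.
Qed.

(** A function at finite distance from an element of L_p is in L_p, so it has a
    class, which is then as close to that element as the function. *)
Lemma Lspace_near_fun (p : \bar R) (p1 : (1 <= p)%E) (f : LspaceType mu p1)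
    (u : X -> R) (c : R) :
  measurable_fun [set: X] u ->
  ('N[mu]_p[EFin \o (fun x => (f x : R) - u x)%R] <= c%:E)%E ->
  exists2 U : LspaceType mu p1, (U : X -> R) = u %[ae mu] & Lspace_dist f U <= c.
Proof.
move=> meas_u fuc; have mf := Lspace_measurable f.
have mfu : measurable_fun [set: X] (fun x => (f x : R) - u x).
  exact: measurable_funB.
have uL : u \in Lfun mu p.
  apply/andP; split; rewrite inE//= /finite_norm.
  rewrite [X in ('N[mu]_p[X] < _)%E](_ : _ =
     EFin \o ((fun x => (f x : R)) \+ (fun x => - ((f x : R) - u x)))%R); last first.
    by apply/funext => x /=; rewrite opprB addrC subrK.
  apply: le_lt_trans (eminkowski mu mf _ p1) _; first exact: measurableT_comp.
  rewrite lte_add_pinfty//; first exact: Lspace_finite.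
  rewrite (_ : _ \o _ = \- (EFin \o (fun x => (f x : R) - u x)%R))%E// oppe_Lnorm.
  exact: le_lt_trans fuc (ltry _).
exists (Lspace_class p1 uL); first exact: Lspace_classE.
rewrite -lee_fin Lspace_distE; apply: le_trans fuc.
rewrite le_eqVlt; apply/orP; left; apply/eqP; apply: ae_eq_Lnorm => //.
  by apply: measurable_funB => //; exact: Lspace_measurable.
by apply: filterS (Lspace_classE p1 uL) => x /(_ I) E _; rewrite E.
Qed.

End Norms.

(** * Openness of the multiplication *)

(** The statement is symmetric in the two exponents, and either of them may be
    infinite. *)
Lemma ball_Lspace_mul (d : measure_display) (X : measurableType d)
    (R : realType) (mu : {measure set X -> \bar R}) (p q : \bar R)
    (p1 : (1 <= p)%E) (q1 : (1 <= q)%E) (pq : (p^-1 + q^-1 = 1)%E)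
    (e : R) (f : LspaceType mu p1) (g : LspaceType mu q1) : 0 < e ->
  ball (Lspace_mul pq f g) (e ^+ 2 / 4)
    `<=` Lspace_mul_set pq (ball f e) (ball g e).
Proof.
move=> e0 h; rewrite Lspace_ballE /= => fgh.
have [mf mg mh] : [/\ measurable_fun [set: X] (f : X -> R),
    measurable_fun [set: X] (g : X -> R) & measurable_fun [set: X] (h : X -> R)].
  by split; exact: Lspace_measurable.
set D := Lspace_dist _ _ in fgh.
have D0 : 0 <= D by rewrite -lee_fin Lspace_distE Lnorm_ge0.
pose m := (D + e ^+ 2 / 4) / 2.
have m0 : 0 < m by rewrite /m; lra.
have Dm : D <= m by rewrite /m; lra.
have me : m < e ^+ 2 / 4 by rewrite /m; lra.
pose c := 2 * Num.sqrt m.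
have c0 : 0 <= c by rewrite mulr_ge0.
have c2 : c * c = 4 * m.
  by rewrite /c mulrACA -[Num.sqrt m * _]expr2 sqr_sqrtr ?ltW//; lra.
have ce : c < e.
  by rewrite -(@ltr_pXn2r _ 2)// ?nnegrE ?(ltW e0)// [c ^+ 2]expr2 c2; lra.
pose w x : R := h x - f x * g x.
have mw : measurable_fun [set: X] w.
  by apply: measurable_funB => //; exact: measurable_funM.
have wm : ('N[mu]_1[EFin \o w] <= m%:E)%E.
  rewrite -lee_fin Lspace_distE in Dm; apply: le_trans Dm.
  rewrite -oppe_Lnorm le_eqVlt; apply/orP; left; apply/eqP.
  apply: (@ae_eq_Lnorm _ _ _ mu 1 (\- w)) => //.
  - exact: measurableT_comp.
  - by apply: measurable_funB => //; exact: Lspace_measurable.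
  - by apply: filterS (Lspace_mulE pq f g) => x /(_ I) E _ /=; rewrite E opprB.
have pq1 : fine p^-1 + fine q^-1 = 1.
  have inv_fin (s : \bar R) : (1 <= s)%E -> s^-1%E \is a fin_num.
    case: s => [s| |]// s1.
    by rewrite inver gt_eqF// (lt_le_trans ltr01).
  by rewrite -fineD ?inv_fin// pq.
pose A x := c * (`|w x| / m) `^ fine p^-1.
pose B x := c * (`|w x| / m) `^ fine q^-1.
have A0 x : 0 <= A x by rewrite mulr_ge0// powR_ge0.
have B0 x : 0 <= B x by rewrite mulr_ge0// powR_ge0.
have AB x : A x * B x = 4 * `|w x|.
  rewrite mulrACA c2 -powRD ?pq1 ?oner_eq0//.
  rewrite powRr1 ?(divr_ge0 _ (ltW m0))//.
  by rewrite mulrACA divff ?gt_eqF// mulr1.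
have mpow s : measurable_fun [set: X] (fun x => c * (`|w x| / m) `^ s).
  apply: measurable_funM => //.
  apply: (measurableT_comp (f := @powR R ^~ s)); first exact: measurable_powR.
  by apply: measurable_funM => //; exact: measurableT_comp.
have [meas_u meas_v] := @measurable_factors _ _ _ A B _ _ _ (mpow _) (mpow _) mf mg mw.
set u := (X in measurable_fun _ X) in meas_u.
set v := (X in measurable_fun _ X) in meas_v.
have [U Uu fU] : exists2 U : LspaceType mu p1,
    (U : X -> R) = u %[ae mu] & Lspace_dist f U <= c.
  apply: Lspace_near_fun => //; apply: (@Lnorm_le_powR _ _ _ _ _ _ w _ m) => //.
    exact: measurable_funB.
  by move=> x; exact: left_factor_close.
have [V Vv gV] : exists2 V : LspaceType mu q1,
    (V : X -> R) = v %[ae mu] & Lspace_dist g V <= c.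
  apply: Lspace_near_fun => //; apply: (@Lnorm_le_powR _ _ _ _ _ _ w _ m) => //.
    exact: measurable_funB.
  by move=> x; exact: right_factor_close.
exists U; first by rewrite Lspace_ballE /=; exact: le_lt_trans fU ce.
exists V; first by rewrite Lspace_ballE /=; exact: le_lt_trans gV ce.
apply/Lspace_eqP.
apply: filterS3 (Lspace_mulE pq U V) Uu Vv => x /(_ I) -> /(_ I) -> /(_ I) -> _.
by rewrite /u /v factors_mul// /w addrC subrK.
Qed.

Theorem theorem2 (d : measure_display) (X : measurableType d) (R : realType)
    (mu : {measure set X -> \bar R}) (p q : \bar R)
    (p1 : (1 <= p)%E) (p_fin : (p < +oo)%E) (q1 : (1 < q)%E)
    (pq : (p^-1 + q^-1 = 1)%E) :
  uniformly_open (fun fg : LspaceType mu p1 * LspaceType mu (ltW q1) =>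
    Lspace_mul pq fg.1 fg.2) /\
  (forall (e : R) (f : LspaceType mu p1) (g : LspaceType mu (ltW q1)), 0 < e ->
    ball (Lspace_mul pq f g) (e ^+ 2 / 4)
      `<=` Lspace_mul_set pq (ball f e) (ball g e)).
Proof.
split=> [e e0|e f g]; last exact: ball_Lspace_mul.
exists (e ^+ 2 / 4) => [|[f g] h]; first by rewrite divr_gt0// exprn_gt0.
by case/(ball_Lspace_mul e0) => u fu [v gv <-]; exists (u, v).
Qed.
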